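(* Fix a block step $i$. Let $\widetilde V_j\in\mathbb R^{n\times r_j}$ ($1\le j\le i$) be the stored blocks, $R_i\in\mathbb R^{n\times r_i}$ the residual block, and let $P_i$, $P_i^{\rm cur}$, $\overline R_i$, $N_i$, $C_i^{\rm old}$ and $\tau_i$ be as defined in the context. Then $$\overline R_i=N_i+C_i^{\rm old},\qquad N_i^TC_i^{\rm old}=0,$$ and consequently $$\overline R_i^T\overline R_i=N_i^TN_i+(C_i^{\rm old})^TC_i^{\rm old}.$$ Suppose that the matrix whose singular values are used for the rank decision has the backward representation $$\widehat R_i=\overline R_i+E_i,\qquad \|E_i\|_2\le\epsilon_i .$$ Put $$d_i=\|C_i^{\rm old}\|_2+\epsilon_i,\qquad \widehat r_i=\#\{j:\sigma_j(\widehat R_i)>\tau_i\}.$$ Then $$\sigma_j(N_i)-\epsilon_i\le\sigma_j(\widehat R_i)\le\sqrt{\sigma_j(N_i)^2+\|C_i^{\rm old}\|_2^2}+\epsilon_i .$$ In particular, $$\#\{j:\sigma_j(N_i)>\tau_i+\epsilon_i\}\le\widehat r_i\le\#\{j:\sigma_j(N_i)>\tau_i-d_i\}.$$ The indices in these sets range from $1$ to $\min(n,r_i)$; if $\tau_i-d_i<0$, the upper bound is understood as the number of singular values in that range. In particular, if $r=\operatorname{rank}(N_i)<r_i$, retaining more than $r$ directions (i.e. $\widehat r_i>r$) requires $$\|C_i^{\rm old}\|_2+\epsilon_i>\tau_i .$$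
   Context: $\mathcal S_i=\operatorname{range}[\,\widetilde V_1\ \cdots\ \widetilde V_i\,]$; $P_i$ and $P_i^{\rm cur}$ are the orthogonal projectors onto $\mathcal S_i$ and $\operatorname{range}(\widetilde V_i)$, respectively. $$\overline R_i=(I-P_i^{\rm cur})R_i,\qquad N_i=(I-P_i)R_i,\qquad C_i^{\rm old}=(P_i-P_i^{\rm cur})R_i .$$ $\sigma_j(\cdot)$ is the $j$th largest singular value and $\|\cdot\|_2$ the spectral norm. The rank threshold is $\tau_i=\vartheta u\max\{\|A\|_2,\|\operatorname{fl}(A\widetilde V_i)\|_2,\|B_i\|_2,\|R_i\|_2\}$, where $\vartheta>0$ is a fixed multiplier, $u$ the unit roundoff, $A=A^T\in\mathbb R^{n\times n}$ the operator, $\operatorname{fl}(A\widetilde V_i)$ the computed product, and $B_i\in\mathbb R^{r_i\times r_{i-1}}$ the stored coupling block of the block Lanczos recurrence. $E_i$ includes the errors in applying the Householder reflectors and computing the compact SVD. *)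

(* Defs.v *)
From HB Require Import structures.
From mathcomp Require Import all_boot all_order all_algebra.
From mathcomp Require Import polyrcf.
From mathcomp Require Import classical_sets reals.
Set Implicit Arguments.
Unset Strict Implicit.
Unset Printing Implicit Defensive.
Import Order.TTheory GRing.Theory Num.Theory.
Local Open Scope classical_set_scope.
Local Open Scope ring_scope.

Section MatrixNotions.
Variable R : realType.

Definition enorm n (x : 'cV[R]_n) : R := Num.sqrt (\sum_k x k 0 ^+ 2).

Definition specnorm m n (M : 'M[R]_(m, n)) : R :=
  sup [set enorm (M *m x) | x in [set x : 'cV[R]_n | enorm x <= 1]].

(* The real roots of the characteristic polynomial, repeated according to their
   multiplicity, in decreasing order. *)
Definition eigenvals n (M : 'M[R]_n) : seq R :=
  let p := char_poly M in
  sort >=%R (flatten [seq nseq (mup x p) x | x <- rootsR p]).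

(* Indices start at 0: [sigma M j] is the (j+1)-st largest singular value of M;
   it is meant for j < minn m n, the eigenvalues of M^T M beyond this range
   being the zeros due to the shape of M. *)
Definition sigma m n (M : 'M[R]_(m, n)) (j : nat) : R :=
  Num.sqrt (nth 0 (eigenvals (M^T *m M)) j).

Definition nsv_gt m n (M : 'M[R]_(m, n)) (t : R) : nat :=
  #|[pred j : 'I_(minn m n) | t < sigma M j]|.

(* MathComp subspaces are row spaces: <<M^T>> encodes the range of M, and
   kermx M, the rows u with u *m M = 0, its orthogonal complement.  The
   projection along the latter is transposed in order to act on columns. *)
Definition orthproj n p (M : 'M[R]_(n, p)) : 'M[R]_n :=
  (proj_mx <<M^T>>%MS (kermx M))^T.

(* The horizontal concatenation [V_1 ... V_i]; V 0 is not used. *)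
Definition blocks n (r : nat -> nat) (V : forall j, 'M[R]_(n, r j)) (i : nat) :
    'M[R]_(n, \sum_(j < i) r j.+1) :=
  \mxrow_(j < i) V j.+1.

(* The spaces used in [orthproj] are complementary because R is real. *)

Lemma mulmx_tr_eq0 n (x : 'rV[R]_n) : x *m x^T = 0 -> x = 0.
Proof.
move=> /matrixP/(_ 0 0); rewrite !mxE => /eqP.
under eq_bigr => k _ do rewrite mxE -expr2.
rewrite psumr_eq0 => [/allP h|k _]; last exact: sqr_ge0.
apply/rowP=> k; rewrite mxE; apply/eqP; rewrite -sqrf_eq0.
by have /implyP := h k (mem_index_enum k); apply.
Qed.

Lemma range_cap_ker n p (M : 'M[R]_(n, p)) : (<<M^T>> :&: kermx M)%MS = 0.
Proof.
apply/eqP/rowV0P => v; rewrite sub_capmx genmxE => /andP[/submxP[w ->]].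
by move=> /sub_kermxP h; apply: mulmx_tr_eq0; rewrite trmx_mul trmxK mulmxA h mul0mx.
Qed.

Lemma range_add_ker n p (M : 'M[R]_(n, p)) q (W : 'M_(q, n)) :
  (W <= <<M^T>> + kermx M)%MS.
Proof.
apply: submx_full; rewrite /row_full mxrank_disjoint_sum ?range_cap_ker //.
by rewrite mxrank_gen mxrank_tr mxrank_ker subnKC // rank_leq_row.
Qed.

Lemma orthprojM n p (M : 'M[R]_(n, p)) : orthproj M *m M = M.
Proof.
apply: trmx_inj; rewrite trmx_mul trmxK.
by rewrite proj_mx_id ?range_cap_ker ?genmxE.
Qed.

Lemma orthproj_compl n p (M : 'M[R]_(n, p)) : M^T *m (1%:M - orthproj M) = 0.
Proof.
apply: trmx_inj; rewrite trmx_mul trmxK trmx0 linearB /= trmx1 trmxK.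
apply/sub_kermxP.
by have := proj_mx_compl_sub (range_add_ker M 1%:M); rewrite mul1mx.
Qed.

Lemma orthproj_range n p (M : 'M[R]_(n, p)) : ((orthproj M)^T :=: M^T)%MS.
Proof.
apply/eqmxP/andP; split.
  by rewrite trmxK -(mul1mx (proj_mx _ _)) -(genmxE M^T) proj_mx_sub.
by rewrite -{1}(orthprojM M) trmx_mul submxMl.
Qed.

Lemma orthproj_sym n p (M : 'M[R]_(n, p)) : (orthproj M)^T = orthproj M.
Proof.
have /submxP[D hD] : ((orthproj M)^T <= M^T)%MS by rewrite orthproj_range.
have h : (orthproj M)^T *m (1%:M - orthproj M) = 0.
  by rewrite hD -mulmxA orthproj_compl mulmx0.
move/eqP: h; rewrite mulmxBr mulmx1 subr_eq0 => /eqP h.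
by apply: trmx_inj; rewrite h trmx_mul trmxK.
Qed.

End MatrixNotions.

(* Main.v *)
(* Courant-Fischer in vector form: for A and B with the same number of columns
   and every index j there is a unit vector x with sigma_j(A) <= |A x| and
   |B x| <= sigma_j(B), since the span of the leading j right singular vectors
   of A and that of the trailing ones of B from the j-th on have dimensions
   adding up to one more than the number of columns.  Comparing |A x| with
   |B x| pointwise then yields all the singular value inequalities: E changes
   |M x| by at most its spectral norm, and orthogonality of N and C gives
   |(N + C) x|^2 = |N x|^2 + |C x|^2.  The orthonormal eigenbasis of a real
   symmetric matrix comes from induction on its size, deflating a real
   eigenvector with a Householder reflection. *)
Require Import Defs.
From mathcomp Require Import all_boot all_order all_algebra.
From mathcomp Require Import classical_sets reals.
From mathcomp Require Import perm polyrcf complex ring lra.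
Set Implicit Arguments.
Unset Strict Implicit.
Unset Printing Implicit Defensive.
Import Order.TTheory GRing.Theory Num.Theory.
Local Open Scope ring_scope.

(** * Orthogonal diagonalization of real symmetric matrices *)

(** Over the complex extension [F[i]] the matrix is Hermitian, so its unitary diagonalization has
    real entries. The first of them is a root of the characteristic polynomial, and this descends to
    [F] because the embedding is injective. *)
Lemma symmetric_eigenvalue (F : rcfType) n (A : 'M[F]_n.+1) :
  A^T = A -> exists a, eigenvalue A a.
Proof.
move=> symA; pose f : {rmorphism F -> F[i]} := real_complex F.
pose B := map_mx f A.
have symB : B \is symmetricmx.
  apply/is_hermitianmxP/matrixP => i j; rewrite expr0 scale1r !mxE /=.
  by rewrite -[in RHS]symA mxE.
have realB : B \is a realmx.
  by apply/mxOverP => i j; rewrite mxE complex_real.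
have hermB := realsym_hermsym symB realB.
have /orthomx_spectralP defB := hermitian_normalmx hermB.
have /mxOverP/(_ 0 0) := hermitian_spectral_diag_real hermB.
set a := spectral_diag B 0 0 => /complex_realP [k ak].
have unitP := spectral_unit B.
have eigB : eigenvalue B a.
  apply/eigenvalueP; exists (row 0 (spectralmx B)).
    rewrite {2}defB !mulmxA -row_mul mulmxV // -row_mul mul1mx.
    by rewrite row_diag_mx -scalemxAl -rowE.
  apply/eqP => row0.
  have : row 0 (spectralmx B) *m invmx (spectralmx B) = 0 by rewrite row0 mul0mx.
  rewrite -row_mul mulmxV // row1 => /rowP/(_ 0)/eqP.
  by rewrite !mxE !eqxx oner_eq0.
exists k; rewrite eigenvalue_root_char; move: eigB.
rewrite eigenvalue_root_char -map_char_poly ak.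
by rewrite /root (horner_map f) fmorph_eq0.
Qed.

Lemma mul_trmx_coord (F : pzSemiRingType) n (x y : 'cV[F]_n) :
  (x^T *m y) 0 0 = \sum_k x k 0 * y k 0.
Proof. by rewrite mxE; apply: eq_bigr => k _; rewrite mxE. Qed.

Lemma orthogonal_mx_to_unit (R : realType) n (v e : 'rV[R]_n) :
  v *m v^T = 1%:M -> e *m e^T = 1%:M ->
  exists2 Q : 'M[R]_n, Q *m Q^T = 1%:M & e *m Q = v.
Proof.
move=> v1 e1; pose w := v - e; pose t := (w *m w^T) 0 0.
(* Q is the reflection exchanging e and v; it degenerates when v = e. *)
have wwT : w *m w^T = t%:M by exact: mx11_scalar.
have [t0|tN0] := eqVneq t 0.
  exists 1%:M; first by rewrite trmx1 mulmx1.
  by rewrite mulmx1; apply/esym/eqP; rewrite -subr_eq0; apply/eqP/mulmx_tr_eq0;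
     rewrite wwT t0 raddf0.
have evT : e *m v^T = v *m e^T.
  by rewrite [LHS]mx11_scalar -tr_scalar_mx -mx11_scalar trmx_mul trmxK.
pose s := (v *m e^T) 0 0.
have veT : v *m e^T = s%:M by exact: mx11_scalar.
have tE : t = 2 - s *+ 2.
  rewrite /t /w linearB /= mulmxBl !mulmxBr v1 e1 evT veT !mxE eqxx !mulr1n.
  ring.
have ewT : e *m w^T = (s - 1)%:M.
  by rewrite /w linearB /= mulmxBr e1 evT veT -raddfB.
have wE : w = v - e by [].
clearbody w t s; pose Q := 1%:M - (2 / t) *: (w^T *m w).
have QT : Q^T = Q by rewrite /Q linearB linearZ /= trmx1 trmx_mul trmxK.
have WW : w^T *m w *m (w^T *m w) = t *: (w^T *m w).
  by rewrite mulmxA -(mulmxA w^T) wwT mul_mx_scalar scalemxAl.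
exists Q.
  rewrite QT /Q mulmxBl mul1mx mulmxBr mulmx1 -scalemxAl -scalemxAr WW !scalerA.
  have -> : 2 / t * (2 / t) * t = 2 / t + 2 / t by field.
  by rewrite scalerDl opprB addrK subrK.
rewrite /Q mulmxBr mulmx1 -scalemxAr mulmxA ewT mul_scalar_mx scalerA.
(* As t = 2 - 2s, the number s - 1 is -t/2, so e Q = e + w = v. *)
have -> : 2 / t * (s - 1) = -1.
  have -> : s = 1 - t / 2 by rewrite tE; field.
  by field.
by rewrite scaleN1r opprK wE addrC subrK.
Qed.

Lemma symmetric_diagonalization (R : realType) n (A : 'M[R]_n) :
  A^T = A -> exists (P : 'M[R]_n) (d : 'rV[R]_n),
    P *m P^T = 1%:M /\ P *m A *m P^T = diag_mx d.
Proof.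
elim: n A => [|n IHn] A symA.
  by exists 1%:M, 0; split; apply/matrixP => -[].
have [a /eigenvalueP [v0 v0A v0N0]] := symmetric_eigenvalue symA.
have [v [vA v1]] : exists v : 'rV_n.+1, v *m A = a *: v /\ v *m v^T = 1%:M.
  pose s := (v0 *m v0^T) 0 0.
  have v0v0 : v0 *m v0^T = s%:M by exact: mx11_scalar.
  have s_ge0 : 0 <= s.
    by rewrite /s mxE sumr_ge0 // => k _; rewrite mxE -expr2 sqr_ge0.
  have sN0 : s != 0.
    apply: contra_neq v0N0 => s0; apply: mulmx_tr_eq0.
    by rewrite v0v0 s0 raddf0.
  exists ((Num.sqrt s)^-1 *: v0); split.
    by rewrite -scalemxAl v0A !scalerA mulrC.
  rewrite linearZ /= -scalemxAl -scalemxAr v0v0 scalerA scale_scalar_mx.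
  by rewrite -invfM -expr2 sqr_sqrtr // mulVf.
pose e : 'rV[R]_(1 + n) := delta_mx 0 0.
have e1 : e *m e^T = 1%:M.
  by rewrite trmx_delta mul_delta_mx; apply/matrixP => i j; rewrite !ord1 !mxE.
have [Q QQ eQ] := orthogonal_mx_to_unit v1 e1.
pose B : 'M[R]_(1 + n) := Q *m A *m Q^T.
have symB : B^T = B by rewrite /B !trmx_mul trmxK symA mulmxA.
have eB : e *m B = a *: e.
  by rewrite /B !mulmxA eQ vA -scalemxAl -eQ -mulmxA QQ mulmx1.
have BE : B = Q *m A *m Q^T by [].
clearbody B.
(* The relation e B = a e fixes the first row of B. By symmetry the first column has the same form,
   so B is block diagonal and the induction applies to its lower right block. *)
have Bu : usubmx B = a *: e.
  rewrite -eB /e -rowE; apply/matrixP => i j; rewrite !mxE ord1.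
  by congr (B _ _); apply: val_inj.
have Bul : ulsubmx B = a%:M.
  rewrite /ulsubmx Bu; apply/matrixP => i j; rewrite !ord1 !mxE /=.
  by rewrite mulr1n mulr1.
have Bur : ursubmx B = 0.
  rewrite /ursubmx Bu; apply/matrixP => i j; rewrite !ord1 !mxE /=.
  by rewrite mulr0.
have Bdl : dlsubmx B = 0 by rewrite -symB -trmx_ursub Bur trmx0.
have [P [d [P1 Pd]]] := IHn (drsubmx B) (etrans (trmx_drsub _) (congr1 _ symB)).
pose U : 'M[R]_(1 + n) := block_mx 1%:M 0 0 P.
have U1 : U *m U^T = 1%:M.
  rewrite /U tr_block_mx mulmx_block !trmx0 trmx1 !mulmx0 !mul0mx !mulmx1.
  by rewrite !addr0 !add0r P1 -scalar_mx_block.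
exists (U *m Q), (row_mx a%:M d); split.
  by rewrite trmx_mul mulmxA -(mulmxA U) QQ mulmx1.
have -> : U *m Q *m A *m (U *m Q)^T = U *m B *m U^T.
  by rewrite BE trmx_mul !mulmxA.
rewrite -[B]submxK Bul Bur Bdl /U tr_block_mx !mulmx_block !trmx0 trmx1.
rewrite !(mulmx0, mul0mx, mulmx1, mul1mx, addr0, add0r) Pd.
apply/esym/(etrans (diag_mx_row a%:M d)).
by congr block_mx; apply/matrixP => i j; rewrite !ord1 !mxE.
Qed.

(** * The sorted list of eigenvalues as a diagonal form *)

Lemma mup_prod_XsubC (F : fieldType) (x : F) (s : seq F) :
  mup x (\prod_(a <- s) ('X - a%:P)) = count_mem x s.
Proof.
elim: s => [|a s IHs] /=; first by rewrite big_nil mupNroot // root1.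
rewrite big_cons mupM ?IHs ?polyXsubC_eq0 //; last first.
  by rewrite monic_neq0 // monic_prod_XsubC.
by rewrite -['X - _]expr1 mup_XsubCX; case: (a == x).
Qed.

(** Orthogonal conjugation preserves the characteristic polynomial, which is therefore the product
    of the X - d_i. Both lists then contain each x as often as its multiplicity as a root. *)
Lemma perm_eigenvals (R : realType) n (A P : 'M[R]_n) (d : 'rV[R]_n) :
  P *m P^T = 1%:M -> P *m A *m P^T = diag_mx d ->
  perm_eq (eigenvals A) [seq d 0 i | i <- enum 'I_n].
Proof.
move=> P1 PA; set s := [seq _ | _ <- _].
have pE : char_poly A = \prod_(a <- s) ('X - a%:P).
  have <- : char_poly (diag_mx d) = \prod_(a <- s) ('X - a%:P).
    rewrite char_poly_trig ?diag_mx_is_trig // /s big_map big_enum /=.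
    by apply: eq_bigr => i _; rewrite mxE eqxx.
  have Pu : \det (map_mx polyC P) * \det (map_mx polyC P^T) = 1.
    by rewrite -det_mulmx -map_mxM P1 map_mx1 det1.
  rewrite -PA /char_poly.
  have -> : char_poly_mx (P *m A *m P^T)
      = map_mx polyC P *m char_poly_mx A *m map_mx polyC P^T.
    rewrite /char_poly_mx mulmxBr mulmxBl mul_mx_scalar -scalemxAl.
    by rewrite -!map_mxM P1 map_mx1 scalemx1.
  by rewrite !det_mulmx mulrAC Pu mul1r.
have p_neq0 : char_poly A != 0 by rewrite monic_neq0 // char_poly_monic.
rewrite /eigenvals perm_sort; apply/allP => x _ /=; apply/eqP.
rewrite -(mup_prod_XsubC x s) -pE count_flatten -map_comp sumnE big_map /=.
under eq_bigr => y _ do rewrite count_nseq /=.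
have rootE : (x \in rootsR (char_poly A)) = root (char_poly A) x.
  by have /(_ x) := roots_on_rootsR p_neq0; rewrite in_itv /= => <-.
(* Among the concatenated constant lists only the one belonging to the root x contributes copies of
   x; if x is not a root, both counts vanish. *)
have [xroot|xNroot] := boolP (x \in rootsR (char_poly A)).
  rewrite (bigD1_seq x) ?uniq_roots //= eqxx mul1n big1 ?addn0 // => y yNx.
  by rewrite (negPf yNx).
rewrite mupNroot -?rootE // big_seq big1 // => y yroot.
by case: eqP => // yx; rewrite -yx yroot in xNroot.
Qed.

(** Permuting the rows of P, which are the eigenvectors, puts the diagonal in decreasing order. *)
Lemma eigenvals_diagonalization (R : realType) n (A : 'M[R]_n) : A^T = A ->
  exists2 P : 'M[R]_n, P *m P^T = 1%:M
    & P *m A *m P^T = diag_mx (\row_k (eigenvals A)`_k).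
Proof.
move=> /symmetric_diagonalization[P [d [P1 PA]]].
have /tuple_permP[p eigE] : perm_eq (eigenvals A) [tuple d 0 i | i < n].
  exact: perm_eigenvals P1 PA.
have permE B : row_perm p P *m B *m (row_perm p P)^T
    = row_perm p (col_perm p (P *m B *m P^T)).
  by rewrite (row_permE p P) trmx_mul tr_perm_mx row_permE col_permE !mulmxA.
exists (row_perm p P).
  (* Orthogonality is the case B = 1 of [permE]. *)
  rewrite -[X in X *m _]mulmx1 permE mulmx1 P1; apply/matrixP => i j.
  by rewrite !mxE (inj_eq perm_inj).
rewrite permE PA; apply/matrixP => i j; rewrite !mxE (inj_eq perm_inj) eigE.
by rewrite (nth_map i) ?size_enum_ord // nth_ord_enum tnth_mktuple.
Qed.

Lemma size_eigenvals (R : realType) n (A : 'M[R]_n) :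
  A^T = A -> size (eigenvals A) = n.
Proof.
move=> /symmetric_diagonalization[P [d [P1 PA]]].
by rewrite (perm_size (perm_eigenvals P1 PA)) size_map size_enum_ord.
Qed.

Lemma eigenvals_nincr (R : realType) n (A : 'M[R]_n) (j k : 'I_n) :
  A^T = A -> (j <= k)%N -> (eigenvals A)`_k <= (eigenvals A)`_j.
Proof.
move=> symA jk; apply: (sorted_leq_nth (leT := >=%R)) => //.
- exact: ge_trans.
- by move=> x; exact: lexx.
- exact/sort_sorted/ge_total.
- by rewrite inE size_eigenvals.
- by rewrite inE size_eigenvals.
Qed.

(** * The Euclidean norm and its inequalities *)

Section EuclideanNorm.
Variable R : realType.

Lemma enorm_ge0 n (x : 'cV[R]_n) : 0 <= enorm x.
Proof. exact: sqrtr_ge0. Qed.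

Lemma sqr_enorm n (x : 'cV[R]_n) : enorm x ^+ 2 = (x^T *m x) 0 0.
Proof.
rewrite sqr_sqrtr; last by apply: sumr_ge0 => k _; exact: sqr_ge0.
by rewrite mxE; apply: eq_bigr => k _; rewrite mxE expr2.
Qed.

Lemma enorm_eq0 n (x : 'cV[R]_n) : enorm x = 0 -> x = 0.
Proof.
move=> x0; apply: trmx_inj; rewrite trmx0; apply: mulmx_tr_eq0.
by rewrite trmxK [LHS]mx11_scalar -sqr_enorm x0 expr0n raddf0.
Qed.

Lemma enormZ n (a : R) (x : 'cV[R]_n) : enorm (a *: x) = `|a| * enorm x.
Proof.
rewrite /enorm -sqrtr_sqr -sqrtrM ?sqr_ge0 // mulr_sumr.
by congr Num.sqrt; apply: eq_bigr => k _; rewrite mxE exprMn.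
Qed.

Lemma mul_trmx_enorm n (x : 'cV[R]_n) : x^T *m x = (enorm x ^+ 2)%:M.
Proof. by rewrite sqr_enorm -mx11_scalar. Qed.

Lemma mul_trmxC n (x y : 'cV[R]_n) : y^T *m x = x^T *m y.
Proof.
by rewrite [LHS]mx11_scalar -tr_scalar_mx -mx11_scalar trmx_mul trmxK.
Qed.

Lemma cauchy_schwarz n (x y : 'cV[R]_n) : (x^T *m y) 0 0 <= enorm x * enorm y.
Proof.
have [y0|yN0] := eqVneq (enorm y) 0.
  by rewrite (enorm_eq0 y0) mulmx0 mxE mulr_ge0 ?enorm_ge0.
have y_gt0 : 0 < enorm y by rewrite lt_def yN0 enorm_ge0.
have := mx11_scalar (x^T *m y); set c := (x^T *m y) 0 0 => xy.
have yx : y^T *m x = c%:M by rewrite mul_trmxC.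
(* This square equals |y|^2 (|x|^2 |y|^2 - c^2), and the factor |y|^2 is positive. *)
have : 0 <= enorm (enorm y ^+ 2 *: x + - c *: y) ^+ 2 by exact: sqr_ge0.
rewrite sqr_enorm [(_ + _)^T]linearD !linearZ /= mulmxDl !mulmxDr.
rewrite -!scalemxAl -!scalemxAr yx xy !mul_trmx_enorm !mxE !mulr1n => h.
have {}h : 0 <= enorm y ^+ 2 * ((enorm x * enorm y) ^+ 2 - c ^+ 2).
  by apply: le_trans h _; rewrite le_eqVlt; apply/orP; left; apply/eqP; ring.
move: h; rewrite pmulr_rge0 ?exprn_gt0 // subr_ge0 => h.
apply: le_trans (ler_norm c) _; rewrite -ler_sqr ?nnegrE ?normr_ge0 //.
  by rewrite real_normK ?num_real.
by rewrite mulr_ge0 ?enorm_ge0.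
Qed.

Lemma enormD n (x y : 'cV[R]_n) : enorm (x + y) <= enorm x + enorm y.
Proof.
rewrite -ler_sqr ?nnegrE ?addr_ge0 ?enorm_ge0 //.
rewrite sqr_enorm [(_ + _)^T]linearD /= mulmxDl !mulmxDr !mul_trmx_enorm.
rewrite (mul_trmxC x y).
have := cauchy_schwarz x y; have := mx11_scalar (x^T *m y).
set c := (x^T *m y) 0 0 => -> h; rewrite !mxE !mulr1n; nra.
Qed.
End EuclideanNorm.

(** * Singular values through the Gram matrix *)

Section SingularValues.
Variable R : realType.

Lemma specnorm_ub m n (M : 'M[R]_(m, n)) (x : 'cV[R]_n) :
  enorm x <= 1 -> enorm (M *m x) <= specnorm M.
Proof.
move=> x1; apply: sup_upper_bound; last by exists x.
split; first by exists (enorm (M *m x)), x.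
(* A supremum is an upper bound only if the set is nonempty and bounded. The bound holds since every
   coordinate of a vector z with |z| <= 1 has modulus at most 1. *)
exists (Num.sqrt (\sum_i (\sum_k `|M i k|) ^+ 2)) => _ [z z1 <-].
apply: ler_wsqrtr; apply: ler_sum => i _.
rewrite -[leLHS]real_normK ?num_real // ler_sqr ?nnegrE ?sumr_ge0 // mxE.
 apply: le_trans (ler_norm_sum _ _ _) _.
apply: ler_sum => k _; rewrite normrM ler_piMr //.
rewrite -ler_sqr ?nnegrE //; apply: le_trans (_ : enorm z ^+ 2 <= _).
  rewrite sqr_enorm mul_trmx_coord real_normK ?num_real // (bigD1 k) //= -expr2.
  by rewrite lerDl sumr_ge0 // => l _; rewrite -expr2 sqr_ge0.
by rewrite expr1n exprn_ile1 ?enorm_ge0.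
Qed.

Lemma specnorm_ge0 m n (M : 'M[R]_(m, n)) : 0 <= specnorm M.
Proof.
apply: le_trans (enorm_ge0 (M *m 0)) (specnorm_ub _ _).
by rewrite -(scale0r 0) enormZ normr0 mul0r.
Qed.

Lemma sigma_ge0 m n (M : 'M[R]_(m, n)) j : 0 <= sigma M j.
Proof. exact: sqrtr_ge0. Qed.

Lemma tr_gram m n (M : 'M[R]_(m, n)) : (M^T *m M)^T = M^T *m M.
Proof. by rewrite trmx_mul trmxK. Qed.

(** Here y holds the coordinates of the vector in the basis formed by the rows of P, in which the
    quadratic form |M x|^2 is diagonal. *)
Lemma sqr_enorm_gram m n (M : 'M[R]_(m, n)) (P : 'M[R]_n) (d y : 'rV[R]_n) :
  P *m (M^T *m M) *m P^T = diag_mx d ->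
  enorm (M *m (y *m P)^T) ^+ 2 = \sum_k d 0 k * y 0 k ^+ 2.
Proof.
move=> PMd; rewrite sqr_enorm !trmx_mul !trmxK.
have -> : y *m P *m M^T *m (M *m (P^T *m y^T)) =
    y *m (P *m (M^T *m M) *m P^T) *m y^T by rewrite !mulmxA.
rewrite PMd mul_mx_diag mxE; apply: eq_bigr => k _.
by rewrite !mxE mulrAC mulrC expr2.
Qed.

Lemma sqr_enorm_orthogonal n (P : 'M[R]_n) (y : 'rV[R]_n) :
  P *m P^T = 1%:M -> enorm (y *m P)^T ^+ 2 = \sum_k y 0 k ^+ 2.
Proof.
move=> P1; rewrite sqr_enorm trmxK trmx_mul mulmxA -(mulmxA y) P1 mulmx1 mxE.
by apply: eq_bigr => k _; rewrite mxE expr2.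
Qed.

(** Only eigenvalues up to index j enter, each at least the j-th, with weights y_k^2 of sum 1. *)
Lemma sigma_le_enorm m n (M : 'M[R]_(m, n)) (P : 'M[R]_n) (y : 'rV[R]_n)
    (j : 'I_n) :
  P *m P^T = 1%:M ->
  P *m (M^T *m M) *m P^T = diag_mx (\row_k (eigenvals (M^T *m M))`_k) ->
  enorm (y *m P)^T = 1 -> (forall k : 'I_n, (j < k)%N -> y 0 k = 0) ->
  sigma M j <= enorm (M *m (y *m P)^T).
Proof.
move=> P1 PMd y1 yj; rewrite -[leRHS]ger0_norm ?enorm_ge0 // -sqrtr_sqr.
(* [Num.sqrt] is monotone on the whole line, being 0 on negative reals, so the comparison can be
   made under the root. *)
apply: ler_wsqrtr; rewrite (sqr_enorm_gram _ PMd) -[leLHS]mulr1.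
rewrite -[X in _ * X](expr1n _ 2) -y1 sqr_enorm_orthogonal // mulr_sumr.
apply: ler_sum => k _; rewrite mxE; have [kj|jk] := leqP k j.
  by rewrite ler_wpM2r ?sqr_ge0 // eigenvals_nincr // tr_gram.
by rewrite yj // expr0n !mulr0.
Qed.

(** Mirror case: the eigenvalues that enter have index at least j and are at most the j-th. *)
Lemma enorm_le_sigma m n (M : 'M[R]_(m, n)) (P : 'M[R]_n) (y : 'rV[R]_n)
    (j : 'I_n) :
  P *m P^T = 1%:M ->
  P *m (M^T *m M) *m P^T = diag_mx (\row_k (eigenvals (M^T *m M))`_k) ->
  enorm (y *m P)^T = 1 -> (forall k : 'I_n, (k < j)%N -> y 0 k = 0) ->
  enorm (M *m (y *m P)^T) <= sigma M j.
Proof.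
move=> P1 PMd y1 yj; rewrite -[leLHS]ger0_norm ?enorm_ge0 // -sqrtr_sqr.
apply: ler_wsqrtr; rewrite (sqr_enorm_gram _ PMd) -[leRHS]mulr1.
rewrite -[X in _ * X](expr1n _ 2) -y1 sqr_enorm_orthogonal // mulr_sumr.
apply: ler_sum => k _; rewrite mxE; have [jk|kj] := leqP j k.
  by rewrite ler_wpM2r ?sqr_ge0 // eigenvals_nincr // tr_gram.
by rewrite yj // expr0n !mulr0.
Qed.

Lemma courant_fischer_vector m1 m2 n (A : 'M[R]_(m1, n)) (B : 'M[R]_(m2, n))
    (j : 'I_n) :
  exists x : 'cV[R]_n,
    [/\ enorm x = 1, sigma A j <= enorm (A *m x) & enorm (B *m x) <= sigma B j].
Proof.
have [P P1 PA] := eigenvals_diagonalization (tr_gram A).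
have [Q Q1 QB] := eigenvals_diagonalization (tr_gram B).
pose T := P *m Q^T.
(* y *m S = 0 says that y has no coordinate after j in the eigenbasis of A and
   none before j in that of B; column j of S imposes nothing, so S is singular. *)
pose S : 'M[R]_n := \matrix_(i, k)
  (if (k < j)%N then T i k else if (j < k)%N then (i == k)%:R else 0).
have /det0P[y0 y0N0 y0S] : \det S == 0.
  rewrite (expand_det_col _ j) big1 // => i _.
  by rewrite mxE ltnn mul0r.
pose c := enorm (y0 *m P)^T.
have cN0 : c != 0.
  apply: contra_neq y0N0 => /enorm_eq0/(congr1 trmx).
  rewrite trmxK trmx0 => /(congr1 (mulmx^~ P^T)).
  by rewrite -mulmxA P1 mulmx1 mul0mx.
pose y := c^-1 *: y0.
have yS k : (y *m S) 0 k = 0 by rewrite /y -scalemxAl y0S scaler0 mxE.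
have x1 : enorm (y *m P)^T = 1.
  rewrite /y -scalemxAl linearZ /= enormZ -/c ger0_norm ?mulVf //.
  by rewrite invr_ge0 enorm_ge0.
(* The same vector has coordinates y in the eigenbasis of A and y T in that of B. *)
have yP : y *m P = y *m T *m Q.
  by rewrite /T !mulmxA -mulmxA (mulmx1C Q1) mulmx1.
exists (y *m P)^T; split=> //.
  apply: sigma_le_enorm => // k jk; rewrite -[RHS](yS k) [RHS]mxE.
  rewrite (bigD1 k) //= big1.
    by rewrite [S _ _]mxE ltnNge (ltnW jk) jk eqxx mulr1 addr0.
  by move=> l lk; rewrite [S _ _]mxE ltnNge (ltnW jk) jk (negPf lk) mulr0.
rewrite yP; apply: enorm_le_sigma => //; first by rewrite -yP.
move=> k kj; rewrite -[RHS](yS k) mxE [RHS]mxE; apply: eq_bigr => l _.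
by rewrite [S _ _]mxE kj.
Qed.

(** The positive singular values select nonzero diagonal entries of the diagonalized Gram matrix.
    The corresponding principal submatrix is invertible, and the rank of M^T M is at most that of
    M. *)
Lemma nsv_gt0_le_rank m n (M : 'M[R]_(m, n)) : (nsv_gt M 0 <= \rank M)%N.
Proof.
have [P P1 PM] := eigenvals_diagonalization (tr_gram M).
have [Pu _] := mulmx1_unit P1.
apply: leq_trans (mxrankM_maxr M^T M).
set d := \row_k _ in PM.
have <- : \rank (diag_mx d) = \rank (M^T *m M).
  rewrite -PM mxrankMfree ?row_free_unit ?unitmx_tr //.
  rewrite -mxrank_tr trmx_mul mxrankMfree ?mxrank_tr //.
  by rewrite row_free_unit unitmx_tr.
pose g (i : 'I_(nsv_gt M 0)) : 'I_n := widen_ord (geq_minr m n) (enum_val i).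
have g_inj : injective g.
  by move=> i j /(congr1 val) /= /val_inj; exact: enum_val_inj.
have -> : nsv_gt M 0 = \rank (mxsub g g (diag_mx d)).
  have -> : mxsub g g (diag_mx d) = diag_mx (\row_i d 0 (g i)).
    by apply/matrixP => i j; rewrite !mxE (inj_eq g_inj).
  apply/esym/eqP; rewrite -[_ == _]/(row_free _) row_free_unit unitmxE det_diag.
  rewrite unitfE; apply/prodf_neq0 => i _; rewrite !mxE.
  have := enum_valP i; rewrite inE /sigma sqrtr_gt0 => /lt0r_neq0.
  by apply.
rewrite mxsubrc; apply: leq_trans (mxrankS (rowsub_sub _ _)) _.
by rewrite -[X in mxsub _ _ X]mulmx1 -mulmx_colsub mxrankM_maxl.
Qed.

Lemma nsv_gt_lt0 m n (M : 'M[R]_(m, n)) t : t < 0 -> nsv_gt M t = minn m n.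
Proof.
move=> t0; rewrite -[RHS]card_ord; apply: eq_card => j.
by rewrite !inE (lt_le_trans t0) ?sigma_ge0.
Qed.

Lemma nsv_gt_mono m n (M N : 'M[R]_(m, n)) s t :
  (forall j : 'I_(minn m n), s < sigma M j -> t < sigma N j) ->
  (nsv_gt M s <= nsv_gt N t)%N.
Proof.
move=> h; rewrite /nsv_gt; apply/subset_leq_card/fintype.subsetP => j.
by rewrite !inE; exact: h.
Qed.

End SingularValues.

(** * Perturbation bounds for singular values *)

Section SingularValuePerturbation.
Variables (R : realType) (m n : nat).
Implicit Types (M N C E : 'M[R]_(m, n)).

Lemma sigma_le_addr p (M : 'M[R]_(p, n)) N (eps : R) (j : 'I_n) :
  (forall x, enorm x = 1 -> enorm (M *m x) <= enorm (N *m x) + eps) ->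
  sigma M j <= sigma N j + eps.
Proof.
move=> MN; have [x [x1 Mx Nx]] := courant_fischer_vector M N j.
by apply: le_trans Mx (le_trans (MN x x1) _); rewrite lerD2r.
Qed.

Lemma sigma_perturbation M E (j : 'I_n) :
  `|sigma (M + E) j - sigma M j| <= specnorm E.
Proof.
rewrite ler_distl; apply/andP; split; first rewrite lerBlDr.
  (* For this direction M x is written as (M + E) x - E x. *)
  apply: sigma_le_addr => x x1; rewrite mulmxDl.
  rewrite -[M *m x in leLHS](addrK (E *m x)).
  apply: le_trans (enormD _ _) _; rewrite lerD2l.
  by rewrite -scaleN1r enormZ normrN1 mul1r specnorm_ub ?x1.
apply: sigma_le_addr => x x1; rewrite mulmxDl.
by apply: le_trans (enormD _ _) _; rewrite lerD2l specnorm_ub ?x1.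
Qed.

Lemma sqr_enorm_orthogonal_sum N C (x : 'cV[R]_n) : N^T *m C = 0 ->
  enorm ((N + C) *m x) ^+ 2 = enorm (N *m x) ^+ 2 + enorm (C *m x) ^+ 2.
Proof.
move=> NC; have NCx : (N *m x)^T *m (C *m x) = 0.
  by rewrite trmx_mul mulmxA -(mulmxA x^T) NC mulmx0 mul0mx.
rewrite mulmxDl sqr_enorm [(_ + _)^T]linearD /= mulmxDl !mulmxDr.
rewrite (mul_trmxC (N *m x)) NCx addr0 add0r !mul_trmx_enorm.
by rewrite !mxE !mulr1n.
Qed.

Lemma sigma_le_orthogonal_sum N C (j : 'I_n) :
  N^T *m C = 0 -> sigma N j <= sigma (N + C) j.
Proof.
move=> NC; rewrite -[leRHS]addr0; apply: sigma_le_addr => x _.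
rewrite addr0 -ler_sqr ?nnegrE ?enorm_ge0 //.
by rewrite sqr_enorm_orthogonal_sum // lerDl sqr_ge0.
Qed.

(** The bound is quadratic, not additive, so the Courant-Fischer vector is used directly: at x, |N
    x| is at most sigma_j(N) and |C x| at most the spectral norm. *)
Lemma sigma_orthogonal_sum_le N C (j : 'I_n) : N^T *m C = 0 ->
  sigma (N + C) j <= Num.sqrt (sigma N j ^+ 2 + specnorm C ^+ 2).
Proof.
move=> NC; have [x [x1 NCx Nx]] := courant_fischer_vector (N + C) N j.
apply: le_trans NCx _; rewrite -[leLHS]ger0_norm ?enorm_ge0 // -sqrtr_sqr.
apply: ler_wsqrtr; rewrite sqr_enorm_orthogonal_sum //.
rewrite lerD ?ler_sqr ?nnegrE ?enorm_ge0 ?sigma_ge0 ?specnorm_ge0 //.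
by rewrite specnorm_ub ?x1.
Qed.

End SingularValuePerturbation.

(** * Nested orthogonal projectors *)

Section OrthogonalProjectors.
Variables (R : realType) (n : nat).

(** The hypothesis places the range of W inside that of M. The columns of [orthproj W] are
    combinations of those of W, hence fixed as well; W = M gives idempotence. *)
Lemma orthproj_idem p q (M : 'M[R]_(n, p)) (W : 'M[R]_(n, q)) :
  orthproj M *m W = W -> orthproj M *m orthproj W = orthproj W.
Proof.
move=> MW; have /submxP[D WD] : ((orthproj W)^T <= W^T)%MS.
  by rewrite orthproj_range.
by rewrite -[orthproj W]trmxK WD trmx_mul trmxK mulmxA MW.
Qed.

Lemma orthproj_blocks (r : nat -> nat) (V : forall j, 'M[R]_(n, r j)) i :
  (0 < i)%N -> orthproj (blocks V i) *m V i = V i.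
Proof.
case: i => // i _; have := orthprojM (blocks V i.+1).
(* The projector fixes every block of the concatenation; the block with the last index [ord_max] is
   [V i.+1], because of the shift in [blocks]. *)
rewrite {2 3}/blocks mul_mxrow => /eq_mxrowP/(_ ord_max).
exact.
Qed.

End OrthogonalProjectors.

(** * The residual splitting and the rank decision *)

Theorem proposition7 (R : realType) (n : nat) (r : nat -> nat)
    (V : forall j : nat, 'M[R]_(n, r j)) (i : nat) (i_gt0 : (0 < i)%N)
    (Ri : 'M[R]_(n, r i))
    (A : 'M[R]_n) (A_sym : A = A^T)
    (flAV : 'M[R]_(n, r i)) (B : 'M[R]_(r i, r i.-1))
    (vartheta u : R) (vartheta_gt0 : 0 < vartheta) (u_gt0 : 0 < u) :
  let P := orthproj (blocks V i) in
  let Pcur := orthproj (V i) in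
  let Rbar := (1%:M - Pcur) *m Ri in
  let N := (1%:M - P) *m Ri in
  let Cold := (P - Pcur) *m Ri in
  let tau := vartheta * u *
    Num.max (specnorm A)
      (Num.max (specnorm flAV) (Num.max (specnorm B) (specnorm Ri))) in
  [/\ Rbar = N + Cold,
      N^T *m Cold = 0,
      Rbar^T *m Rbar = N^T *m N + Cold^T *m Cold &
      forall (E : 'M[R]_(n, r i)) (eps : R), specnorm E <= eps ->
        let Rhat := Rbar + E in
        let d := specnorm Cold + eps in
        let rhat := nsv_gt Rhat tau in
        [/\ forall j : 'I_(minn n (r i)),
              sigma N j - eps <= sigma Rhat j
                <= Num.sqrt (sigma N j ^+ 2 + specnorm Cold ^+ 2) + eps,
            (nsv_gt N (tau + eps) <= rhat)%N,
            (rhat <= nsv_gt N (tau - d))%N,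
            tau - d < 0 -> nsv_gt N (tau - d) = minn n (r i) &
            (\rank N < r i)%N -> (\rank N < rhat)%N ->
              tau < specnorm Cold + eps]].
Proof.
move=> P Pcur Rbar N Cold tau.
have PP : P *m P = P by apply: orthproj_idem; exact: orthprojM.
have PPcur : P *m Pcur = Pcur by apply: orthproj_idem; exact: orthproj_blocks.
have RbarE : Rbar = N + Cold by rewrite /Rbar -mulmxDl addrA subrK.
have NCold : N^T *m Cold = 0.
  (* By symmetry of P the product is Ri^T (1 - P)(P - Pcur) Ri, and the middle factor vanishes
     because P P = P and P Pcur = Pcur. *)
  rewrite trmx_mul linearB /= trmx1 orthproj_sym -/P -mulmxA.
  rewrite (mulmxA (1%:M - P)) mulmxBl mul1mx mulmxBr PP PPcur subrr mul0mx.
  by rewrite mulmx0.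
clearbody N Cold tau; rewrite {}RbarE {Rbar}.
split; [by []|by []| |move=> E eps Eeps].
  have CN : Cold^T *m N = 0 by rewrite -[LHS]trmxK trmx_mul trmxK NCold trmx0.
  by rewrite [(_ + _)^T]linearD /= mulmxDl !mulmxDr NCold CN addr0 add0r.
move=> Rhat d rhat.
have sigma_bounds (j : 'I_(minn n (r i))) : sigma N j - eps <= sigma Rhat j
    <= Num.sqrt (sigma N j ^+ 2 + specnorm Cold ^+ 2) + eps.
  (* The perturbation bounds are indexed by the columns, so j is recast as an index below [r i]. *)
  have j_ri : (j < r i)%N by apply: leq_trans (ltn_ord j) (geq_minr _ _).
  pose k := Ordinal j_ri; rewrite -[nat_of_ord j]/(nat_of_ord k).
  have := le_trans (sigma_perturbation (N + Cold) E k) Eeps.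
  rewrite ler_distl => /andP[lo hi]; apply/andP; split.
    by apply: le_trans lo; rewrite lerD2r sigma_le_orthogonal_sum.
  by apply: le_trans hi _; rewrite lerD2r sigma_orthogonal_sum_le.
have sigma_ub (j : 'I_(minn n (r i))) : sigma Rhat j <= sigma N j + d.
  have /andP[_ /le_trans] := sigma_bounds j; apply.
  rewrite /d addrA lerD2r.
  (* For nonnegative a and c, sqrt(a^2 + c^2) <= a + c. *)
  rewrite -[leRHS]ger0_norm ?addr_ge0 ?sigma_ge0 ?specnorm_ge0 //.
  rewrite -sqrtr_sqr ler_wsqrtr // sqrrD lerD2r lerDl.
  by rewrite mulrn_wge0 // mulr_ge0 ?sigma_ge0 ?specnorm_ge0.
have rhat_le : (rhat <= nsv_gt N (tau - d))%N.
  by apply: nsv_gt_mono => j tauj; rewrite ltrBlDr (lt_le_trans tauj).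
split; [exact: sigma_bounds| |exact: rhat_le|exact: nsv_gt_lt0|].
- apply: nsv_gt_mono => j; rewrite -ltrBrDr => /lt_le_trans; apply.
  by have /andP[] := sigma_bounds j.
(* By contraposition: if d <= tau, the threshold tau - d is nonnegative, so [rhat] is at most the
   number of positive singular values of N, hence at most its rank. *)
- move=> _ rank_lt; rewrite ltNge; apply: contraTN rank_lt => d_tau.
  rewrite -leqNgt; apply: leq_trans rhat_le _.
  apply: leq_trans (nsv_gt0_le_rank N); apply: nsv_gt_mono => j.
  by apply: le_lt_trans; rewrite subr_ge0.
Qed.
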